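(* $$d_{\rm BM}\big(C([0,\omega]\times 3),\,C[0,\omega]\big)\ \le\ \frac{4+\sqrt[3]{73-6\sqrt{87}}+\sqrt[3]{73+6\sqrt{87}}}{3}\ \approx\ 3.87512\ldots$$
   Context: $C(K)$ is the Banach space of real-valued continuous functions on the compact space $K$ with the supremum norm. $[0,\omega]$ is the ordinal interval $\omega+1$ with the order topology, i.e. a convergent sequence together with its limit; $C[0,\omega]$ denotes $C([0,\omega])$. Here $3=\{0,1,2\}$ is discrete, so $[0,\omega]\times 3$ is the disjoint union of three copies of $[0,\omega]$. For isomorphic Banach spaces $X,Y$, $d_{\rm BM}(X,Y)=\inf\{\|T\|\cdot\|T^{-1}\| : T:X\to Y \text{ an isomorphism}\}$, where an isomorphism is a bounded linear bijection (with bounded inverse). *)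

(* Defs.v *)
From HB Require Import structures.
From mathcomp Require Import all_boot all_order all_algebra.
From mathcomp Require Import all_classical all_reals all_analysis.
From mathcomp Require Import ring.

Set Implicit Arguments.
Unset Strict Implicit.
Unset Printing Implicit Defensive.

Import Order.TTheory GRing.Theory Num.Theory.
Import numFieldNormedType.Exports.

Local Open Scope classical_set_scope.
Local Open Scope ring_scope.

HB.mixin Record isCompactSpace T & Topological T := {
  compact_setT : compact [set: T]
}.

#[short(type="compactType")]
HB.structure Definition CompactSpace := {T of Topological T & isCompactSpace T}.

Lemma prod_compact_setT (K L : compactType) : compact [set: K * L].
Proof. by rewrite -setXTT; apply: compact_setX; exact: compact_setT. Qed.

HB.instance Definition _ (K L : compactType) :=
  isCompactSpace.Build (K * L)%type (@prod_compact_setT K L).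

(** The ordinal omega + 1: [Some n] is the finite ordinal [n] and [None] is
    omega, so that as a set it is the interval [0, omega]. *)
Definition omegaS : Type := option nat.

HB.instance Definition _ := Choice.on omegaS.

Definition omegaS_le (x y : omegaS) : bool :=
  match x, y with
  | _, None => true
  | None, Some _ => false
  | Some m, Some n => (m <= n)%N
  end.

Lemma omegaS_le_refl : reflexive omegaS_le.
Proof. by case=> /=. Qed.

Lemma omegaS_le_anti : antisymmetric omegaS_le.
Proof. by move=> [m|] [n|] //= /anti_leq ->. Qed.

Lemma omegaS_le_trans : transitive omegaS_le.
Proof. by move=> [m|] [n|] [p|] //=; exact: leq_trans. Qed.

Lemma omegaS_le_total : total omegaS_le.
Proof. by move=> [m|] [n|] //=; exact: leq_total. Qed.

Fact omegaS_display : Order.disp_t. Proof. exact: Order.Disp tt tt. Qed.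

HB.instance Definition _ := @Order.Le_isPOrder.Build omegaS_display omegaS
  omegaS_le omegaS_le_refl omegaS_le_anti omegaS_le_trans.
HB.instance Definition _ :=
  Order.POrder_isTotal.Build omegaS_display omegaS omegaS_le_total.

Definition omega_itv : Type := order_topology omegaS.

HB.instance Definition _ := OrderTopological.on omega_itv.

Lemma omega_itv_nbhs_omega (U : set omega_itv) :
  nbhs (None : omega_itv) U -> exists N, forall n, (N < n)%N -> U (Some n).
Proof.
rewrite itv_nbhsE => -[[l r] [/= io iN] iU].
have rE : r = +oo%O.
  case: r io iN {iU} => [b r|[]]; rewrite /itv_open_ends //.
  - rewrite in_itv /= => + /andP[_].
    by case: b; case: r => [r|] //=; case: l => [[]|[]].
  - by rewrite in_itv /= andbF.
subst r.
case: l io iN iU => [b l|b] io iN iU.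
- have bE : b = false by case: b io {iN iU} => //; rewrite /itv_open_ends.
  subst b; move: iN; rewrite in_itv /= andbT.
  case: l io iU => // N _ iU _; exists N => n Nn; apply: iU => /=.
  by rewrite in_itv /= andbT lt_def /=; apply/andP; split; [rewrite eqE /= gtn_eqF|exact: ltnW].
- by exists 0%N => n _; apply: iU => /=; rewrite in_itv; case: b io iN.
Qed.

Lemma omega_itv_compact : compact [set: omega_itv].
Proof.
apply/compact_near_coveringP => I F P FF FP.
have [[U V] /= [/omega_itv_nbhs_omega[N NU] FV] UV] := FP None Logic.I.
have FN : \forall i \near F, forall k : 'I_N.+1, P i (Some (k : nat)).
  apply: filter_forall => k.
  have [[A B] /= [nA FB] AB] := FP (Some (k : nat)) Logic.I.
  by apply: filterS FB => i Bi; apply: (AB (Some (k : nat), i)); split => //; exact: nbhs_singleton.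
have FU : \forall i \near F, forall n, (N < n)%N -> P i (Some n).
  by apply: filterS FV => i Vi n Nn; apply: (UV (Some n, i)); split => //; exact: NU.
have FO : \forall i \near F, P i None.
  have [[A B] /= [nA FB] AB] := FP None Logic.I.
  by apply: filterS FB => i Bi; apply: (AB (None, i)); split => //; exact: nbhs_singleton.
apply: filterS3 FN FU FO => i iN iU iO [n|] _ //.
by have [Nn|nN] := ltnP N n; [exact: iU|exact: (iN (Ordinal (nN : (n < N.+1)%N)))].
Qed.

HB.instance Definition _ := isCompactSpace.Build omega_itv omega_itv_compact.

Definition three : Type := discrete_topology 'I_3.

HB.instance Definition _ := DiscreteTopology.on three.

Lemma three_compact : compact [set: three].
Proof.
apply/compact_near_coveringP => I F P FF FP.
have : \forall i \near F, forall k : 'I_3, P i k.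
  apply: filter_forall => k.
  have [[A B] /= [nA FB] AB] := FP k Logic.I.
  by apply: filterS FB => i Bi; apply: (AB (k, i)); split => //; exact: nbhs_singleton.
by apply: filterS => i iP k _; exact: iP.
Qed.

HB.instance Definition _ := isCompactSpace.Build three three_compact.

(** C(K). An alias, because modules such as [ArrowAsProduct] put other
    topologies on [continuousType K R]. *)
Definition cfun (R : realType) (K : compactType) : Type := continuousType K R.

Section cfun.
Context (R : realType) (K : compactType).
Local Notation CK := (cfun R K).
Implicit Types f g h : CK.

HB.instance Definition _ := Choice.copy CK (continuousType K R).

Lemma cfun_continuous f : continuous f.
Proof. exact: cts_fun. Qed.

Lemma cfunP f g : (forall x, f x = g x) -> f = g.
Proof. by move=> fg; apply/continuousEP. Qed.

Lemma cfunD_continuous f g : continuous (fun x => f x + g x).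
Proof. by move=> x; apply: cvgD; exact: cfun_continuous. Qed.

Lemma cfunN_continuous f : continuous (fun x => - f x).
Proof. by move=> x; apply: cvgN; exact: cfun_continuous. Qed.

Lemma cfunZ_continuous (a : R) f : continuous (fun x => a * f x).
Proof. by move=> x; apply: cvgMr; exact: cfun_continuous. Qed.

Definition cfun0 : CK := (cst 0 : continuousType K R).
Definition cfunD f g : CK := (mkcts (@cfunD_continuous f g) : continuousType K R).
Definition cfunN f : CK := (mkcts (@cfunN_continuous f) : continuousType K R).
Definition cfunZ a f : CK := (mkcts (@cfunZ_continuous a f) : continuousType K R).

Lemma cfunDA : associative cfunD.
Proof. by move=> f g h; apply: cfunP => x; exact: addrA. Qed.
Lemma cfunDC : commutative cfunD.
Proof. by move=> f g; apply: cfunP => x; exact: addrC. Qed.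
Lemma cfun0D : left_id cfun0 cfunD.
Proof. by move=> f; apply: cfunP => x; exact: add0r. Qed.
Lemma cfunND : left_inverse cfun0 cfunN cfunD.
Proof. by move=> f; apply: cfunP => x; exact: addNr. Qed.

HB.instance Definition _ :=
  GRing.isZmodule.Build CK cfunDA cfunDC cfun0D cfunND.

Lemma cfunZA a b f : cfunZ a (cfunZ b f) = cfunZ (a * b) f.
Proof. by apply: cfunP => x; exact: mulrA. Qed.
Lemma cfunZ1 : left_id 1 cfunZ.
Proof. by move=> f; apply: cfunP => x; exact: mul1r. Qed.
Lemma cfunZDr : right_distributive cfunZ +%R.
Proof. by move=> a f g; apply: cfunP => x; exact: mulrDr. Qed.
Lemma cfunZDl f : {morph cfunZ^~ f : a b / a + b}.
Proof. by move=> a b; apply: cfunP => x; exact: mulrDl. Qed.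

HB.instance Definition _ :=
  GRing.Zmodule_isLmodule.Build R CK cfunZA cfunZ1 cfunZDr cfunZDl.

Definition cfun_norm f : R := sup [set `|f x| | x in [set: K]].

Lemma cfun_has_ubound f : has_ubound [set `|f x| | x in [set: K]].
Proof.
have /compact_bounded[M [_ fM]] : compact [set f x | x in [set: K]].
  apply: continuous_compact; last exact: compact_setT.
  by apply: continuous_subspaceT; exact: cfun_continuous.
exists (M + 1) => _ [x _ <-]; apply: (fM (M + 1)); first by rewrite ltrDl.
by exists x.
Qed.

Lemma cfun_norm_ub f x : `|f x| <= cfun_norm f.
Proof. by apply: ub_le_sup; [exact: cfun_has_ubound|exists x]. Qed.

Lemma cfun_norm_ge0 f : 0 <= cfun_norm f.
Proof.
rewrite /cfun_norm.
have [->|/set0P[_ [x _ _]]] := eqVneq [set `|f x| | x in [set: K]] set0.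
  by rewrite sup0.
exact: le_trans (normr_ge0 (f x)) (cfun_norm_ub f x).
Qed.

Lemma cfun_norm_le f (M : R) :
  0 <= M -> (forall x, `|f x| <= M) -> cfun_norm f <= M.
Proof.
move=> M0 fM; rewrite /cfun_norm.
have [->|/set0P ne] := eqVneq [set `|f x| | x in [set: K]] set0.
  by rewrite sup0.
by apply: ge_sup => // _ [x _ <-]; exact: fM.
Qed.

Lemma cfun_normD f g : cfun_norm (f + g) <= cfun_norm f + cfun_norm g.
Proof.
apply: cfun_norm_le => [|x]; first by rewrite addr_ge0 ?cfun_norm_ge0.
by apply: le_trans (ler_normD (f x) (g x)) _; rewrite lerD ?cfun_norm_ub.
Qed.

Lemma cfun_normZ (a : R) f : cfun_norm (a *: f) = `|a| * cfun_norm f.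
Proof.
have le_normZ b g : cfun_norm (b *: g) <= `|b| * cfun_norm g.
  apply: cfun_norm_le => [|x]; first by rewrite mulr_ge0 ?cfun_norm_ge0.
  by rewrite [`|_|]normrM ler_wpM2l ?cfun_norm_ub.
apply/eqP; rewrite eq_le le_normZ /=.
have [->|a0] := eqVneq a 0; first by rewrite normr0 mul0r cfun_norm_ge0.
rewrite -ler_pdivlMl ?normr_gt0 // -normfV.
by rewrite -[f in leLHS]scale1r -(mulVf a0) -scalerA le_normZ.
Qed.

Lemma cfun_norm0_eq0 f : cfun_norm f = 0 -> f = 0.
Proof.
move=> f0; apply: cfunP => x; apply/eqP.
by rewrite -normr_le0 -f0 cfun_norm_ub.
Qed.

HB.instance Definition _ :=
  Lmodule_isNormed.Build R CK cfun_normD cfun_normZ cfun_norm0_eq0.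

Lemma cfun_complete (F : set_system CK) :
  ProperFilter F -> cauchy F -> cvg F.
Proof.
move=> FF /cauchy_ballP Fc.
have dist f g x : `|f x - g x| <= `|f - g|.
  exact: (cfun_norm_ub (f - g) x).
pose ev x : CK -> R := fun f => f x.
have evc x : cvg (ev x @ F).
  apply: R_complete; apply/cauchy_ballP => e e0.
  have [[A B] /= [FA FB] AB] := Fc e e0.
  exists (ev x @` A, ev x @` B) => /=.
    by split; [apply: filterS FA|apply: filterS FB] => f Xf; exists f.
  move=> [_ _] /= [[f Af <-] [h Bh <-]].
  have := AB (f, h) (conj Af Bh); rewrite /= -ball_normE /= => fh.
  rewrite -ball_normE /=; exact: le_lt_trans (dist f h x) fh.
pose g x : R := lim (ev x @ F).
have unif (e : R) : 0 < e -> F [set f : CK | forall x, `|f x - g x| <= e].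
  move=> e0; have [[A B] /= [FA FB] AB] := Fc e e0.
  apply: filterS FA => f Af x; apply/ler_addgt0Pr => d d0.
  have /cvgrPdist_lt/(_ d d0) gd := evc x.
  near F => h.
  have fh : `|f x - h x| < e.
    have Bh : B h by near: h.
    have := AB (f, h) (conj Af Bh); rewrite /= -ball_normE /=.
    exact: le_lt_trans (dist f h x).
  have hg : `|g x - h x| < d by near: h.
  rewrite (le_trans (ler_distD (h x) _ _)) // lerD ?(ltW fh) //.
  by rewrite distrC ltW.
have gc : continuous g.
  move=> x; apply/cvgrPdist_le => e e0.
  have e3 : 0 < e / 3 by rewrite divr_gt0.
  have [f fg] := filter_ex (unif _ e3).
  have /cvgrPdist_le/(_ _ e3) := @cfun_continuous f x.
  apply: filterS => y fxy.
  have -> : g x - g y = (g x - f x) + (f x - f y) + (f y - g y).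
    by rewrite !addrA !subrK.
  have -> : e = e / 3 + e / 3 + e / 3 by field.
  rewrite (le_trans (ler_normD _ _)) // lerD //.
  by rewrite (le_trans (ler_normD _ _)) // lerD // distrC.
apply/cvg_ex; exists ((mkcts gc : continuousType K R) : CK).
apply/cvgrPdist_le => e e0; have := unif _ e0; apply: filterS => f fe.
by rewrite distrC; apply: cfun_norm_le (ltW e0) _ => x; exact: fe.
Unshelve. all: by end_near. Qed.

HB.instance Definition _ := Uniform_isComplete.Build CK cfun_complete.

End cfun.

Section banach_mazur.
Context (R : realType).
Local Open Scope ereal_scope.

Definition op_norm (X Y : normedModType R) (T : X -> Y) : \bar R :=
  ereal_sup [set `|T x|%:E | x in [set x : X | (`|x| <= 1)%R]].

Definition bounded_inverse_pair (X Y : normedModType R)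
    (T : {linear X -> Y}) (S : {linear Y -> X}) : Prop :=
  [/\ cancel T S, cancel S T, bounded_fun_norm T & bounded_fun_norm S].

(** [S] is the inverse of [T]; the value is [+oo] when [X] and [Y] are not isomorphic *)
Definition banach_mazur_dist (X Y : completeNormedModType R) : \bar R :=
  ereal_inf [set d | exists (T : {linear X -> Y}) (S : {linear Y -> X}),
    bounded_inverse_pair T S /\ d = op_norm T * op_norm S].

End banach_mazur.

(* Main.v *)
Require Import Defs.
From mathcomp Require Import all_boot all_order all_algebra.
From mathcomp Require Import all_classical all_reals all_analysis.
From mathcomp Require Import ring lra zify.
From HB Require Import structures.

Import Order.TTheory GRing.Theory Num.Theory.
Import numFieldNormedType.Exports.

Local Open Scope classical_set_scope.
Local Open Scope ring_scope.

(** The bound is witnessed by one explicit isomorphism. Let [L = (L0, L1, L2)]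
    be the limits of [f] along the three copies of [0, omega]. Set aside the
    points 0 and 1 of [0, omega] and identify its remaining finite points with
    those of the three copies: [3m + i + 2] stands for the point [m] of copy
    [i]. For an invertible [3 x 3] matrix [M] with last row [phi] and nonzero
    scalars [a0, a1, a2], define [T f] by
      [(Tf(0), Tf(1), Tf(omega)) = M L],
      [Tf(3m + i + 2) = a_i (f(m, i) - L_i) + phi . L].
    The values of [T f] along copy [i] converge to [phi . L], which is
    [Tf(omega)], so [T f] is continuous. It is inverted by reading [L] off the
    three values at 0, 1, omega. Both norms are bounded by maxima of finitely
    many l1-norms of functionals ([gather_norm_le], [spread_norm_le]), and the
    distance is thereby reduced to an optimization over [M] and [a]
    ([banach_mazur_dist_matrix_le]).

    A good choice treats copies 0 and 1 symmetrically: rows proportional to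
    [(1, -1, 0)] and [(1, 1, -(1 + w))], a last row [(p, p, q)], and scalars
    [(w, w, w (1 + w) / 2)]. The parameters are fixed by requiring that as
    many as possible of the competing l1-norms coincide: for [T] the rows 0
    and 1 and all the tails have norm exactly 2; for the inverse all the rows
    and all the tails have norm [(3 + w) / 2]. These requirements can be met when
    [x = 3 + w] is a root of [x^3 - 4 x^2 + x - 2], and then the product of
    the two norm bounds is [x] ([banach_mazur_dist_le_root]).

    The bound of the theorem is this root in Cardano's form
    ([bm_cubic_radical]); since the cubic increases beyond 3, its signs at two
    neighbouring decimals give the numerical enclosure. *)

(** * Convergence and continuity on [0, omega] and its three copies *)

Lemma omega_itv_ltE (m n : nat) :
  ((Some m : omega_itv) < (Some n : omega_itv))%O = (m < n)%N.
Proof. by rewrite lt_def /= [LHS]/= ltn_neqAle eq_sym. Qed.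

Lemma omega_itv_isolated (n : nat) : nbhs (Some n : omega_itv) [set Some n].
Proof.
(* the predecessor of [Some n], which is missing when [n = 0] *)
pose l : itv_bound omega_itv :=
  if n is m.+1 then BRight (Some m : omega_itv) else -oo%O.
rewrite itv_nbhsE; exists (Interval l (BLeft (Some n.+1 : omega_itv))) => /=.
  split; first by rewrite /l; case: n {l}.
  by rewrite /l; case: n {l} => [|n]; rewrite in_itv /= !omega_itv_ltE ?ltnSn.
case=> [k|]; rewrite /l; case: n {l} => [|n]; rewrite /= in_itv /= ?andbF //.
- by rewrite omega_itv_ltE => k1; congr Some; lia.
- by rewrite !omega_itv_ltE => /andP[nk kn]; congr Some; lia.
Qed.

Lemma nbhs_omegaE (U : set omega_itv) : nbhs (None : omega_itv) U <->
  U None /\ \forall n \near \oo, U (Some n).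
Proof.
split=> [nU|[U0 [N _ NU]]].
  split; first exact: (nbhs_singleton nU).
  by have [N NU] := omega_itv_nbhs_omega nU; exists N.+1 => // n /NU.
rewrite itv_nbhsE; exists (Interval (BRight (Some N : omega_itv)) +oo%O) => /=.
  by split=> //; rewrite in_itv.
case=> [n|] //=; rewrite in_itv /= andbT lt_def /= => /andP[_ Nn].
exact: NU.
Qed.

Section continuity.
Context {R : realType}.

Lemma continuous_omega_itv (h : omega_itv -> R) :
  (fun n => h (Some n)) @ \oo --> h None -> continuous h.
Proof.
move=> hc [n|] U.
  move=> /nbhs_singleton hU; apply: filterS (omega_itv_isolated n) => _ -> //.
by move=> hU; apply/nbhs_omegaE; split; [exact: nbhs_singleton|exact: hc].
Qed.

(** The discrete second factor lets continuity be tested copy by copy. *)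
Lemma continuous_omega_itv_three (h : omega_itv * three -> R) :
  (forall i, (fun n => h (Some n, i)) @ \oo --> h (None, i)) -> continuous h.
Proof.
move=> hc [x i] U hU.
suff: nbhs x [set y | U (h (y, i))].
  move=> xU; exists ([set y | U (h (y, i))], [set i]) => /=.
    by split=> //; exact: discrete_set1.
  by case=> y j [/= ? ->].
exact: (continuous_omega_itv (fun y => h (y, i)) (hc i)).
Qed.

Lemma cfun_cvg_omega (g : cfun R omega_itv) :
  (fun n => g (Some n)) @ \oo --> g None.
Proof.
by move=> U /(@cfun_continuous _ _ g) /nbhs_omegaE[].
Qed.

Lemma cfun_cvg_omega_three (f : cfun R (omega_itv * three)%type) i :
  (fun n => f (Some n, i)) @ \oo --> f (None, i).
Proof.
move=> U /(@cfun_continuous _ _ f)[[A B] /= [/nbhs_omegaE[_ nA] nB] AB].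
apply: filterS nA => n An; apply: (AB (Some n, i)); split => //.
exact: nbhs_singleton.
Qed.

End continuity.

(** * The isomorphism attached to a matrix *)

(** The index [n %/ k.+1] reaches any threshold common to the finitely many
    sequences, so their round-robin merge has their common limit. *)
Lemma cvg_interleave {R : realType} k (u : 'I_k.+1 -> nat -> R) (l : R) :
  (forall i, u i @ \oo --> l) ->
  (fun n => u (inord (n %% k.+1)) (n %/ k.+1)%N) @ \oo --> l.
Proof.
move=> ul; apply/cvgrPdist_lt => e e0.
have [N _ uN] : \forall n \near \oo, forall i, `|l - u i n| < e.
  by apply: filter_forall => i; move/cvgrPdist_lt: (ul i); exact.
exists (N * k.+1)%N => // n /= Nn; apply: uN => /=.
by rewrite leq_divRL.
Qed.

Lemma ler_mulmx_col {R : realType} {m n} (A : 'M[R]_(m, n)) (v : 'cV[R]_n) c i :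
  (forall j, `|v j 0| <= c) -> `|(A *m v) i 0| <= (\sum_j `|A i j|) * c.
Proof.
move=> vc; rewrite mxE mulr_suml (le_trans (ler_norm_sum _ _ _)) //.
by apply: ler_sum => j _; rewrite normrM ler_wpM2l.
Qed.

Section transfer.
Context {R : realType}.
Local Notation X := (cfun R (omega_itv * three)%type).
Local Notation Y := (cfun R omega_itv).
Implicit Types (f : X) (g : Y) (a : 'I_3 -> R) (M V : 'M[R]_3).

Definition limits f : 'cV[R]_3 := \col_i f (None, i).

(** The values at 0, 1 and omega: index [2] stands for omega. *)
Definition heads g : 'cV[R]_3 :=
  \col_i g (if (i < 2)%N then Some (i : nat) else None).

(** The forward operator. For [n = 3m + i], the point [n.+2] carries the
    point [m] of copy [i]; subtracting [f (None, i)] before scaling makes the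
    three copies share the limit [(M *m limits f) ord_max 0]. *)
Definition gather_fun a M f (x : omega_itv) : R :=
  match x with
  | None => (M *m limits f) ord_max 0
  | Some n.+2 => let i : 'I_3 := inord (n %% 3) in
      a i * (f (Some (n %/ 3)%N, i) - f (None, i)) + (M *m limits f) ord_max 0
  | Some n => (M *m limits f) (inord n) 0
  end.

Lemma gather_continuous a M f : continuous (gather_fun a M f).
Proof.
apply: continuous_omega_itv; rewrite -(cvg_shiftn 2) /=.
pose u (i : 'I_3) n :=
  a i * (f (Some n, i) - f (None, i)) + (M *m limits f) ord_max 0.
rewrite (_ : (fun n => _) = fun n => u (inord (n %% 3)) (n %/ 3)%N); last first.
  by apply/funext => n; rewrite addn2.
apply: cvg_interleave => i; rewrite -[X in _ --> X]add0r -(mulr0 (a i)).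
rewrite -(subrr (f (None, i))).
apply: cvgD; last exact: cvg_cst.
apply: cvgMr; apply: cvgB; [exact: cfun_cvg_omega_three|exact: cvg_cst].
Qed.

Definition gather a M f : Y :=
  (mkcts (gather_continuous a M f) : continuousType omega_itv R).

Lemma gatherE a M f x : gather a M f x = gather_fun a M f x.
Proof. by []. Qed.

(** The backward operator: if [V] is inverse to [M], then [V *m heads g]
    recovers the three limits of the preimage of [g], after which each copy is
    unscaled. *)
Definition spread_fun a V g (x : omega_itv * three) : R :=
  let l := (V *m heads g) x.2 0 in
  match x.1 with
  | None => l
  | Some m => (g (Some (m * 3 + (x.2 : 'I_3)).+2) - g None) / a x.2 + l
  end.

Lemma spread_continuous a V g : continuous (spread_fun a V g).
Proof.
apply: continuous_omega_itv_three => i; rewrite /spread_fun /=.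
rewrite -[X in _ --> X]add0r -(mul0r (a i)^-1) -(subrr (g None)).
apply: cvgD; last exact: cvg_cst.
apply: cvgMl; apply: cvgB; last exact: cvg_cst.
move=> U /(cfun_cvg_omega g)[N _ gU]; exists N => // n /= Nn; apply: gU => /=.
lia.
Qed.

Definition spread a V g : X :=
  (mkcts (spread_continuous a V g) : continuousType _ R).

Lemma spreadE a V g x : spread a V g x = spread_fun a V g x.
Proof. by []. Qed.

Let col_linear k (u v : 'cV[R]_3) i : (k *: u + v) i 0 = k * u i 0 + v i 0.
Proof. by rewrite !mxE. Qed.

Lemma limits_linear k f f' : limits (k *: f + f') = k *: limits f + limits f'.
Proof. by apply/matrixP => i j; rewrite !mxE. Qed.

Lemma heads_linear k g g' : heads (k *: g + g') = k *: heads g + heads g'.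
Proof. by apply/matrixP => i j; rewrite !mxE. Qed.

Lemma gather_linear a M : linear (gather a M).
Proof.
move=> k f f'; apply: cfunP => x.
rewrite -[RHS]/(k * gather_fun a M f x + gather_fun a M f' x).
rewrite -[LHS]/(gather_fun a M (k *: f + f') x) /gather_fun.
rewrite limits_linear mulmxDr -scalemxAr.
case: x => [[|[|n]]|] /=; rewrite col_linear //.
set i := inord _; set y := Some _.
rewrite -[(k *: f + f') (y, i)]/(k * f (y, i) + f' (y, i)).
rewrite -[(k *: f + f') (None, i)]/(k * f (None, i) + f' (None, i)).
ring.
Qed.

Lemma spread_linear a V : linear (spread a V).
Proof.
move=> k g g'; apply: cfunP => x.
rewrite -[RHS]/(k * spread_fun a V g x + spread_fun a V g' x).
rewrite -[LHS]/(spread_fun a V (k *: g + g') x) /spread_fun.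
rewrite heads_linear mulmxDr -scalemxAr.
case: x => [[m|] i] /=; rewrite col_linear //.
set y := Some _.
rewrite -[(k *: g + g') y]/(k * g y + g' y).
rewrite -[(k *: g + g') None]/(k * g None + g' None).
ring.
Qed.

HB.instance Definition _ a M :=
  GRing.isLinear.Build R X Y *:%R (gather a M) (gather_linear a M).
HB.instance Definition _ a V :=
  GRing.isLinear.Build R Y X *:%R (spread a V) (spread_linear a V).

Lemma heads_gather a M f : heads (gather a M f) = M *m limits f.
Proof.
apply/matrixP => i j; rewrite (ord1 j) [LHS]mxE gatherE.
case: i => [[|[|[|//]]] i3] /=; congr ((M *m limits f) _ _); apply: val_inj => //=.
all: by rewrite inordK.
Qed.

Lemma limits_spread a V g : limits (spread a V g) = V *m heads g.
Proof. by apply/matrixP => i j; rewrite (ord1 j) [LHS]mxE. Qed.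

Lemma gatherK a M V : (forall i, a i != 0) -> V *m M = 1%:M ->
  cancel (gather a M) (spread a V).
Proof.
move=> a0 VM f; apply: cfunP => -[x i].
rewrite spreadE /spread_fun heads_gather mulmxA VM mul1mx mxE /=.
case: x => // m; rewrite !gatherE /= modnMDl divnMDl //.
rewrite modn_small // divn_small // addn0 inord_val addrK.
by rewrite mulrC mulKf // subrK.
Qed.

Lemma spreadK a M V : (forall i, a i != 0) -> M *m V = 1%:M ->
  cancel (spread a V) (gather a M).
Proof.
move=> a0 MV g; apply: cfunP => x.
rewrite gatherE /gather_fun limits_spread mulmxA MV mul1mx.
case: x => [[|[|n]]|]; try by rewrite mxE /= ?inordK.
set i : 'I_3 := inord _; rewrite !spreadE /spread_fun /= addrK.
rewrite mulrC divfK // [heads _ _ _]mxE /= subrK inordK ?ltn_mod //.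
by rewrite -divn_eq.
Qed.

(** Only [f (Some m, i)] and the limits enter a tail value, and
    [- a i * f (None, i)] cancels against part of [phi . L]. Collecting the
    limits therefore gives the functional [phi - a i e_i], whose l1-norm adds to
    the weight [`|a i|] of [f (Some m, i)]. *)
Lemma gather_norm_le a M C f :
  (forall i, \sum_j `|M i j| <= C) ->
  (forall i, `|a i| + \sum_j `|M ord_max j - a i * (j == i)%:R| <= C) ->
  `|gather a M f| <= C * `|f|.
Proof.
move=> MC aC; have C0 : 0 <= C by apply: le_trans (MC ord0); apply: sumr_ge0.
have Lf j : `|limits f j 0| <= `|f| by rewrite mxE; exact: cfun_norm_ub.
have row i : `|(M *m limits f) i 0| <= C * `|f|.
  by rewrite (le_trans (ler_mulmx_col _ _ _ _ Lf)) // ler_wpM2r.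
apply: cfun_norm_le => [|x]; first by rewrite mulr_ge0.
rewrite gatherE /gather_fun; case: x => [[|[|n]]|] //.
set i : 'I_3 := inord _; set y := Some _.
pose N : 'M[R]_3 := \matrix_(_, j) (M ord_max j - a i * (j == i)%:R).
rewrite mulrBr -addrA.
have -> : - (a i * f (None, i)) + (M *m limits f) ord_max 0 = (N *m limits f) 0 0.
  rewrite !mxE addrC.
  under [RHS]eq_bigr do rewrite [N _ _]mxE mulrBl.
  rewrite sumrB; congr (_ - _).
  rewrite (bigD1 i) //= eqxx mulr1 big1 ?addr0 ?mxE // => j /negPf ->.
  by rewrite mulr0 mul0r.
rewrite (le_trans (ler_normD _ _)) //.
apply: le_trans (ler_wpM2r _ (aC i)) => //; rewrite mulrDl lerD //.
  by rewrite normrM ler_wpM2l // cfun_norm_ub.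
rewrite (le_trans (ler_mulmx_col _ _ _ _ Lf)) // ler_wpM2r //.
by apply: ler_sum => j _; rewrite mxE.
Qed.

(** As for [gather_norm_le], with [g None] as the entry that is shared by the
    tail term and the row of [V]. *)
Lemma spread_norm_le a V C g :
  (forall i, \sum_j `|V i j| <= C) ->
  (forall i, `|a i|^-1 + \sum_j `|V i j - (a i)^-1 * (j == ord_max)%:R| <= C) ->
  `|spread a V g| <= C * `|g|.
Proof.
move=> VC aC; have C0 : 0 <= C by apply: le_trans (VC ord0); apply: sumr_ge0.
have Lg j : `|heads g j 0| <= `|g| by rewrite mxE; exact: cfun_norm_ub.
have row i : `|(V *m heads g) i 0| <= C * `|g|.
  by rewrite (le_trans (ler_mulmx_col _ _ _ _ Lg)) // ler_wpM2r.
apply: cfun_norm_le => [|[x i]]; first by rewrite mulr_ge0.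
rewrite spreadE /spread_fun; case: x => [m|] //=.
set y := Some _.
pose N : 'M[R]_3 := \matrix_(_, j) (V i j - (a i)^-1 * (j == ord_max)%:R).
rewrite mulrBl -addrA.
have -> : - (g None / a i) + (V *m heads g) i 0 = (N *m heads g) 0 0.
  rewrite !mxE addrC.
  under [RHS]eq_bigr do rewrite [N _ _]mxE mulrBl.
  rewrite sumrB; congr (_ - _).
  rewrite (bigD1 ord_max) //= mulr1 big1 ?addr0 ?mxE 1?mulrC // => j /negPf ->.
  by rewrite mulr0 mul0r.
rewrite (le_trans (ler_normD _ _)) //.
apply: le_trans (ler_wpM2r _ (aC i)) => //; rewrite mulrDl lerD //.
  by rewrite normrM normfV mulrC ler_wpM2l ?invr_ge0 // cfun_norm_ub.
rewrite (le_trans (ler_mulmx_col _ _ _ _ Lg)) // ler_wpM2r //.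
by apply: ler_sum => j _; rewrite mxE.
Qed.

End transfer.

Lemma banach_mazur_dist_le (R : realType) (X Y : completeNormedModType R)
    (T : {linear X -> Y}) (S : {linear Y -> X}) (C D : R) :
  cancel T S -> cancel S T ->
  (forall x, `|T x| <= C * `|x|) -> (forall y, `|S y| <= D * `|y|) ->
  0 <= C -> 0 <= D ->
  (banach_mazur_dist X Y <= (C * D)%:E)%E.
Proof.
move=> TS ST TC SD C0 D0.
have bnd (U W : completeNormedModType R) (F : {linear U -> W}) E : 0 <= E ->
    (forall x, `|F x| <= E * `|x|) ->
    bounded_fun_norm F /\ (0 <= op_norm F <= E%:E)%E.
  move=> E0 FE; split=> [r|].
    by exists (E * r) => x xr; rewrite (le_trans (FE x)) // ler_wpM2l.
  apply/andP; split.
    apply: ereal_sup_ubound; exists 0; first by rewrite /= normr0 ler01.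
    by rewrite linear0 normr0.
  apply: ge_ereal_sup => _ [x /= x1 <-]; rewrite lee_fin.
  by rewrite (le_trans (FE x)) // -[leRHS]mulr1 ler_wpM2l.
have [bT /andP[T0 TC']] := bnd _ _ T C C0 TC.
have [bS /andP[S0 SD']] := bnd _ _ S D D0 SD.
apply: (@le_trans _ _ (op_norm T * op_norm S)%E); last by rewrite EFinM lee_pmul.
by apply: ereal_inf_lbound; exists T, S; split.
Qed.

(** Reduces the distance to linear algebra on the three limits. The column
    index [i] in [(j == i)] is the limit of the copy where the tail lives, and
    [ord_max] is the value at omega. *)
Lemma banach_mazur_dist_matrix_le (R : realType) (a : 'I_3 -> R) (M V : 'M[R]_3)
    (C D : R) :
  (forall i, a i != 0) -> V *m M = 1%:M ->
  (forall i, \sum_j `|M i j| <= C) ->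
  (forall i, `|a i| + \sum_j `|M ord_max j - a i * (j == i)%:R| <= C) ->
  (forall i, \sum_j `|V i j| <= D) ->
  (forall i, `|a i|^-1 + \sum_j `|V i j - (a i)^-1 * (j == ord_max)%:R| <= D) ->
  (banach_mazur_dist (cfun R (omega_itv * three)%type) (cfun R omega_itv)
    <= (C * D)%:E)%E.
Proof.
move=> a0 VM MC aC VD aD.
have MV : M *m V = 1%:M by exact: mulmx1C.
apply: (@banach_mazur_dist_le _ _ _ (gather a M) (spread a V)).
- exact: gatherK.
- exact: spreadK.
- by move=> f; exact: gather_norm_le.
- by move=> g; exact: spread_norm_le.
- by apply: le_trans (MC ord0); apply: sumr_ge0.
- by apply: le_trans (VD ord0); apply: sumr_ge0.
Qed.

(** * The cubic and its root in radicals *)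

Lemma powR_third_cube {R : realType} (a : R) : 0 <= a -> (a `^ 3^-1) ^+ 3 = a.
Proof.
by move=> a0; rewrite -powR_mulrn ?powR_ge0// -powRrM mulVf ?powRr1.
Qed.

Definition bm_cubic {R : realType} (x : R) := x ^+ 3 - 4 * x ^+ 2 + x - 2.

(** Cardano's formula: if [u] and [v] are the two cube roots, then
    [u v] is the cube root of [73 ^ 2 - 36 * 87 = 13 ^ 3], so [y = u + v]
    satisfies [y ^ 3 = 3 u v y + u ^ 3 + v ^ 3 = 39 y + 146], which is
    the depressed form of the cubic for [y = 3 x - 4]. *)
Lemma bm_cubic_radical (R : realType) :
  let x : R := (4 + (73 - 6 * Num.sqrt 87) `^ (3^-1)
                  + (73 + 6 * Num.sqrt 87) `^ (3^-1)) / 3 in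
  3 < x /\ bm_cubic x = 0.
Proof.
set s := Num.sqrt 87; set u := _ `^ _; set v := (73 + _) `^ _ => x.
have s2 : s ^+ 2 = 87 by rewrite sqr_sqrtr.
have s0 : 0 <= s := sqrtr_ge0 _.
have A0 : 0 <= 73 - 6 * s by nra.
have B0 : 0 <= 73 + 6 * s by lra.
have u3 : u ^+ 3 = 73 - 6 * s by exact: powR_third_cube.
have v3 : v ^+ 3 = 73 + 6 * s by exact: powR_third_cube.
have uv : u * v = 13.
  rewrite /u /v -powRM // (_ : (73 - _) * _ = 13 ^+ 3); last by ring: s2.
  by rewrite -powR_mulrn // -powRrM mulfV // powRr1.
have u0 : 0 <= u by exact: powR_ge0.
have v0 : 0 <= v by exact: powR_ge0.
have y3 : (u + v) ^+ 3 = 39 * (u + v) + 146.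
  have -> : (u + v) ^+ 3 = u ^+ 3 + v ^+ 3 + 3 * (u * v) * (u + v) by ring.
  rewrite u3 v3 uv; ring.
have xE : x = (4 + (u + v)) / 3 by rewrite /x addrA.
move: y3 xE (addr_ge0 u0 v0); move: (u + v) => y y3 -> y0; split.
  (* [y <= 5] would give [y ^ 3 <= 25 y < 39 y + 146] *)
  by have [|] := ltP 5 y; nra.
rewrite /bm_cubic; apply: (mulfI (_ : 27 != 0 :> R)) => //.
have -> : 27 * (((4 + y) / 3) ^+ 3 - 4 * ((4 + y) / 3) ^+ 2 + (4 + y) / 3 - 2)
  = y ^+ 3 - 39 * y - 146 by field.
by rewrite y3; ring.
Qed.

Lemma bm_cubic_increasing {R : realType} (x y : R) :
  3 <= x -> x < y -> bm_cubic x < bm_cubic y.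
Proof.
move=> x3 xy; rewrite /bm_cubic -subr_gt0.
have -> : y ^+ 3 - 4 * y ^+ 2 + y - 2 - (x ^+ 3 - 4 * x ^+ 2 + x - 2) =
  (y - x) * ((x - 2) ^+ 2 + (y - 2) ^+ 2 + (x * y - 7)) by ring.
apply: mulr_gt0; nra.
Qed.

(** * The optimal matrix *)

Section optimal.
Context {R : realType} (w : R).

Let p := 2 - w - w * (1 + w) / 2.
Let q := 2 * (1 - w).

Definition opt_weight (i : 'I_3) : R := nth 0 [:: w; w; w * (1 + w) / 2] i.

Definition mx3 (r : seq (seq R)) : 'M[R]_3 :=
  \matrix_(i, j) nth 0 (nth [::] r i) j.

Definition opt_mx : 'M[R]_3 := mx3
  [:: [:: 1; -1; 0];
      [:: 2 / (3 + w); 2 / (3 + w); - (2 * (1 + w) / (3 + w))];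
      [:: p; p; q]].

Let b := (1 - w) * (3 + w) / (w * (1 + w)).

Definition opt_inv : 'M[R]_3 := mx3
  [:: [:: 2^-1; b; w^-1];
      [:: - 2^-1; b; w^-1];
      [:: 0; - (p * (3 + w) / (w * (1 + w))); 2 / (w * (1 + w))]].

(** An interval around the root that is narrow enough to fix the sign of every
    entry in the norms below. *)
Let w_range := 4 / 5 < w < 9 / 10.

Let w_neq0 : w_range -> [/\ w != 0, 1 + w != 0 & 3 + w != 0].
Proof. by move=> /andP[w45 w1]; split; rewrite gt_eqF //; lra. Qed.

(** The quadratic bounds make the norm estimates linear in [w] and [w * w]. *)
Let w_bounds : w_range ->
  [/\ 4 / 5 < w, w < 9 / 10, w * w <= 17 / 10 * w - 72 / 100 &
      16 / 10 * w - 64 / 100 <= w * w].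
Proof. by move=> /andP[w45 w1]; split=> //; nra. Qed.

(** The condition under which the competing l1-norms coincide. *)
Let w_root := bm_cubic (3 + w) = 0.

(** [opt_inv] inverts [opt_mx] as a rational identity once [p] takes this form;
    the polynomial form is the one that balances the tail of copy 2. *)
Let p_rational : w_range -> w_root -> p = w / 2 - 2 * (1 - w) / (1 + w).
Proof.
move=> /w_neq0[w0 w10 w30] wE.
have wc : 2 * (1 + w) != 0 by rewrite !mulf_neq0.
apply: (mulfI wc); apply/eqP; rewrite -subr_eq0 -oppr_eq0 -[X in _ == X]wE.
by apply/eqP; rewrite /p /bm_cubic; field.
Qed.

Lemma opt_invK : w_range -> w_root -> opt_inv *m opt_mx = 1%:M.
Proof.
move=> wr wE; have [w0 w10 w30] := w_neq0 wr.
apply/matrixP => i j; rewrite !mxE !big_ord_recl big_ord0 !mxE.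
case: i => [[|[|[|//]]] ?]; case: j => [[|[|[|//]]] ?] /=;
  rewrite ?(p_rational wr wE) /b /q; field; by rewrite w0 w10 w30.
Qed.

Lemma opt_weight_neq0 : w_range -> forall i, opt_weight i != 0.
Proof.
move=> /w_bounds[w45 w1 w2l w2g] i.
by rewrite gt_eqF // /opt_weight; case: i => [[|[|[|//]]] ?] /=; lra.
Qed.

(** The factors [2 / (3 + w)] in row 1 are what normalizes its l1-norm to 2. *)
Lemma opt_mx_norm : w_range -> forall i, \sum_j `|opt_mx i j| <= 2.
Proof.
move=> wr i; have [w45 w1 w2l w2g] := w_bounds wr; have [_ _ w30] := w_neq0 wr.
rewrite !big_ord_recl big_ord0 !mxE.
case: i => [[|[|[|//]]] ?] /=.
- by rewrite normrN normr1 normr0; lra.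
- rewrite normrN !ger0_norm ?divr_ge0; try lra.
  rewrite le_eqVlt; apply/orP; left; apply/eqP; field; exact: w30.
- by rewrite /p /q !ger0_norm; lra.
Qed.

(** Since [0 <= p <= w] and [0 <= q <= w (1 + w) / 2], all signs are determined:
    copies 0 and 1 give [2 w + q = 2], and copy 2 gives
    [w (1 + w) - q + 2 p = 2]. *)
Lemma opt_tail_norm : w_range -> forall i,
  `|opt_weight i| + \sum_j `|opt_mx ord_max j - opt_weight i * (j == i)%:R| <= 2.
Proof.
move=> /w_bounds[w45 w1 w2l w2g] i.
rewrite !big_ord_recl big_ord0 !mxE /opt_weight.
case: i => [[|[|[|//]]] ?]; rewrite /= ?mulr1 ?mulr0 ?subr0 /p /q.
- rewrite [`|w|]ger0_norm; last lra.
  rewrite ler0_norm; last lra.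
  by rewrite !ger0_norm; lra.
- rewrite [`|w|]ger0_norm; last lra.
  rewrite [X in _ + (X + _)]ger0_norm; last lra.
  rewrite ler0_norm; last lra.
  by rewrite !ger0_norm; lra.
- rewrite [X in X + _]ger0_norm; last lra.
  rewrite [X in _ + (X + (X + _))]ger0_norm; last lra.
  by rewrite ler0_norm; lra.
Qed.

(** The common l1-norm of the rows 0 and 1 of [opt_inv]; since their last entry
    [w^-1] equals the inverse of the weight, it is also the norm of the tails. *)
Let outer_row_norm : w_range -> w_root -> w^-1 + b + 2^-1 = (3 + w) / 2.
Proof.
move=> /w_neq0[w0 w10 w30] wE.
have wc : 2 * w * (1 + w) != 0 by rewrite !mulf_neq0.
apply: (mulfI wc).
have -> : 2 * w * (1 + w) * (w^-1 + b + 2^-1) = 8 - w - w ^+ 2.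
  by rewrite /b; field; rewrite w0 w10.
have -> : 2 * w * (1 + w) * ((3 + w) / 2) = w * (1 + w) * (3 + w) by field.
apply/eqP; rewrite -subr_eq0 -oppr_eq0 -[X in _ == X]wE /bm_cubic.
by apply/eqP; ring.
Qed.

(** The same coincidence for row 2, whose last entry is again the inverse of the
    weight. *)
Let last_row_norm : w_range -> w_root ->
  2 / (w * (1 + w)) + p * (3 + w) / (w * (1 + w)) = (3 + w) / 2.
Proof.
move=> /w_neq0[w0 w10 w30] wE.
have wc : - (w * (1 + w)) != 0 by rewrite oppr_eq0 mulf_neq0.
apply: (mulfI wc); apply/eqP; rewrite -subr_eq0 -[X in _ == X]wE.
by apply/eqP; rewrite /p /bm_cubic; field; rewrite w0 w10.
Qed.

Let opt_inv_signs : w_range -> [/\ 0 <= b, 0 <= w^-1,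
  0 <= 2 / (w * (1 + w)) & 0 <= p * (3 + w) / (w * (1 + w))].
Proof.
move=> /w_bounds[w45 w1 w2l w2g].
have d0 : 0 <= w * (1 + w) by lra.
by split; rewrite ?invr_ge0 ?divr_ge0 ?mulr_ge0 //; rewrite /p; lra.
Qed.

Lemma opt_inv_norm : w_range -> w_root ->
  forall i, \sum_j `|opt_inv i j| <= (3 + w) / 2.
Proof.
move=> wr wE i; have [b0 v0 c0 r0] := opt_inv_signs wr.
rewrite !big_ord_recl big_ord0 !mxE.
case: i => [[|[|[|//]]] ?] /=; rewrite ?normrN ?normr0 !ger0_norm //.
- by rewrite -outer_row_norm //; lra.
- by rewrite -outer_row_norm //; lra.
- by rewrite -last_row_norm //; lra.
Qed.

Lemma opt_inv_tail_norm : w_range -> w_root -> forall i,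
  `|opt_weight i|^-1 +
    \sum_j `|opt_inv i j - (opt_weight i)^-1 * (j == ord_max)%:R| <= (3 + w) / 2.
Proof.
move=> wr wE i; have [b0 v0 c0 r0] := opt_inv_signs wr.
rewrite -normfV !big_ord_recl big_ord0 !mxE /opt_weight.
case: i => [[|[|[|//]]] ?]; rewrite /= ?invf_div !mulr0 mulr1 !subr0 subrr;
  rewrite ?normrN ?normr0 !ger0_norm //.
- by rewrite -outer_row_norm //; lra.
- by rewrite -outer_row_norm //; lra.
- by rewrite -last_row_norm //; lra.
Qed.

Lemma banach_mazur_dist_le_root : 4 / 5 < w -> w < 9 / 10 ->
  bm_cubic (3 + w) = 0 ->
  (banach_mazur_dist (cfun R (omega_itv * three)%type) (cfun R omega_itv)
    <= (3 + w)%:E)%E.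
Proof.
move=> w45 w1 wE; have wr : w_range by apply/andP.
rewrite (_ : 3 + w = 2 * ((3 + w) / 2)); last by field.
apply: (@banach_mazur_dist_matrix_le _ opt_weight opt_mx opt_inv).
- exact: opt_weight_neq0.
- exact: opt_invK.
- exact: opt_mx_norm.
- exact: opt_tail_norm.
- exact: opt_inv_norm.
- exact: opt_inv_tail_norm.
Qed.

End optimal.

Theorem theorem6p2 (R : realType) :
  let bound : R := (4 + (73 - 6 * Num.sqrt 87) `^ (3^-1)
                      + (73 + 6 * Num.sqrt 87) `^ (3^-1)) / 3 in
  let approx : R :=
    3 + 8 / 10 + 7 / 10 ^+ 2 + 5 / 10 ^+ 3 + 1 / 10 ^+ 4 + 2 / 10 ^+ 5 in
  (banach_mazur_dist (cfun R (omega_itv * three)%type) (cfun R omega_itv)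
     <= bound%:E)%E
  /\ approx <= bound < approx + 1 / 10 ^+ 5.
Proof.
move=> bound approx; have [bound3 boundE] := bm_cubic_radical R.
rewrite -/bound in bound3 boundE.
have lo : approx <= bound.
  rewrite leNgt; apply/negP => /(bm_cubic_increasing _ _ (ltW bound3)).
  by rewrite boundE /approx /bm_cubic; lra.
have hi : bound < approx + 1 / 10 ^+ 5.
  rewrite ltNge le_eqVlt; apply/negP => /orP[/eqP bE|].
    by move: boundE; rewrite -bE /approx /bm_cubic; lra.
  move=> /bm_cubic_increasing; rewrite boundE /approx /bm_cubic => /(_ _); lra.
split; last by rewrite lo hi.
rewrite (_ : bound = 3 + (bound - 3)); last by rewrite addrC subrK.
move: lo hi; rewrite /approx => lo hi.
apply: banach_mazur_dist_le_root; rewrite 1?[3 + _]addrC ?subrK //; lra.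
Qed.
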